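(* Let $d\in\mathbb{N}$ and let $(Y_0,\dots,Y_d)$ follow a standard generalized Pareto distribution with $D$-norm $\|\cdot\|_{D_{0,\dots,d}}$ on $\mathbb{R}^{d+1}$ generated by $(Z_0,\dots,Z_d)$. Let $g_0,\dots,g_d\in\bar C^+[0,1]$ be functions such that $$\|(g_0(t),\dots,g_d(t))\|_{D_{0,\dots,d}}=1,\qquad t\in[0,1].$$ Put $$V_t:=\max_{i=0,\dots,d}\frac{Y_i}{g_i(t)},\qquad t\in[0,1].$$ Then the stochastic process $\boldsymbol V=(V_t)_{t\in[0,1]}$ is a standard generalized Pareto process with generator process $\hat{\boldsymbol Z}=(\hat Z_t)_{t\in[0,1]}$, $$\hat Z_t=\max_{i=0,\dots,d}\bigl(g_i(t)Z_i\bigr),\qquad t\in[0,1].$$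
   Context: $\bar C^+[0,1]$ and $\bar C^-[0,1]$ are the nonnegative and nonpositive functions in $C[0,1]$. $E[0,1]$ is the set of bounded functions $f:[0,1]\to\mathbb{R}$ with only finitely many discontinuities, $\bar E^-[0,1]=\{f\in E[0,1]:f\le0\}$, and $\|\cdot\|_\infty$ is the sup-norm. $D$-norm on $\mathbb{R}^{d+1}$ generated by $(Z_0,\dots,Z_d)$: $\|\boldsymbol x\|_{D_{0,\dots,d}}=E(\max_{0\le i\le d}|x_i|Z_i)$, where $0\le Z_i\le c$ a.s. for some constant $c\ge1$ and $E(Z_i)=1$ for all $i$. Standard generalized Pareto distribution (GPD): $(Y_0,\dots,Y_d)$ follows a standard GPD with $D$-norm $\|\cdot\|_{D_{0,\dots,d}}$ if there is a vector $\boldsymbol y^{(0)}<\boldsymbol0$ (componentwise) such that $P(Y_0\le y_0,\dots,Y_d\le y_d)=1-\|\boldsymbol y\|_{D_{0,\dots,d}}$ for all $\boldsymbol y=(y_0,\dots,y_d)$ with $\boldsymbol y^{(0)}\le\boldsymbol y\le\boldsymbol0$. Generator process: a process $\boldsymbol Z=(Z_t)_{t\in[0,1]}$ with sample paths in $\bar C^+[0,1]$, $Z_t\le c$ a.s. for some constant $c\ge1$ and $E(Z_t)=1$ for all $t$; it generates the $D$-norm $\|f\|_D=E(\sup_{t\in[0,1]}|f(t)|Z_t)$ on $E[0,1]$. Standard generalized Pareto process (SGPP): a process $\boldsymbol V$ with sample paths in $\bar C^-[0,1]$ for which there are a $D$-norm $\|\cdot\|_D$ on $E[0,1]$ and some $c_0>0$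 with $P(\boldsymbol V\le f)=1-\|f\|_D$ for all $f\in\bar E^-[0,1]$ with $\|f\|_\infty\le c_0$. A generator process of $\boldsymbol V$ is a generator process of this $D$-norm. Convention: $Y_i<0$ a.s., and $x/0:=-\infty$ for $x<0$. *)

(* Defs.v *)
From HB Require Import structures.
From mathcomp Require Import all_boot all_order all_algebra.
From mathcomp Require Import all_classical all_reals all_analysis.
Set Implicit Arguments.
Unset Strict Implicit.
Unset Printing Implicit Defensive.
Import Order.TTheory GRing.Theory Num.Theory.
Import numFieldNormedType.Exports.
Local Open Scope classical_set_scope.
Local Open Scope ring_scope.

(* Functions on [0,1] are represented by total functions on R of which only
   the restriction to [0,1] matters.  Processes indexed by [0,1] are likewise
   families X : R -> T -> R, X t w being the value at time t. *)
Definition unitI (R : realType) : set R := `[0, 1].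
Arguments unitI : clear implicits.

Definition Cplus (R : realType) (f : R -> R) : Prop :=
  {within unitI R, continuous f} /\ forall t, unitI R t -> 0 <= f t.

Definition Cminus (R : realType) (f : R -> R) : Prop :=
  {within unitI R, continuous f} /\ forall t, unitI R t -> f t <= 0.

Definition discontinuities (R : realType) (f : R -> R) : set R :=
  [set t | unitI R t /\ ~ (f @ within (unitI R) (nbhs t) --> f t)].

Definition Efun (R : realType) (f : R -> R) : Prop :=
  (exists M : R, forall t, unitI R t -> `|f t| <= M) /\
  finite_set (discontinuities f).

Definition Eminus (R : realType) (f : R -> R) : Prop :=
  Efun f /\ forall t, unitI R t -> f t <= 0.

Definition supnorm (R : realType) (f : R -> R) : R :=
  sup [set `|f t| | t in unitI R].

(* Exact maximum over the nonempty index set {0, ..., d}. *)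
Definition omax (R : realType) (d : nat) (F : 'I_d.+1 -> R) : R :=
  \big[Num.max/F ord0]_(i < d.+1) F i.

(* "P(A) = p" with respect to the completion of P.  An event such as
   {V_t <= f(t) for all t in [0,1]} involves uncountably many t; when the
   paths are continuous only almost surely, it is in general measurable only
   up to a P-null set.  For a measurable A this is just P A = p. *)
Definition prob_eq (R : realType) (dT : measure_display)
    (T : measurableType dT) (P : probability T R) (A : set T) (p : \bar R)
    : Prop :=
  exists B : set T, [/\ measurable B, P.-negligible (A `+` B) & P B = p].

Definition gen_vector (R : realType) (dT : measure_display)
    (T : measurableType dT) (Q : probability T R) (d : nat)
    (Z : 'I_d.+1 -> {RV Q >-> R}) : Prop :=
  [/\ forall i, {ae Q, forall w, 0 <= Z i w},
      exists2 c : R, 1 <= c & forall i, {ae Q, forall w, Z i w <= c}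
    & forall i, ('E_Q[Z i] = 1)%E].

Definition Dnorm_vec (R : realType) (dT : measure_display)
    (T : measurableType dT) (Q : probability T R) (d : nat)
    (Z : 'I_d.+1 -> {RV Q >-> R}) (x : 'I_d.+1 -> R) : \bar R :=
  ('E_Q[(fun w => omax (fun i => `|x i| * Z i w))%R])%E.

Definition standard_GPD (R : realType) (dT : measure_display)
    (T : measurableType dT) (P : probability T R) (d : nat)
    (Y : 'I_d.+1 -> {RV P >-> R}) (N : ('I_d.+1 -> R) -> \bar R) : Prop :=
  exists2 y0 : 'I_d.+1 -> R, (forall i, y0 i < 0) &
    forall y : 'I_d.+1 -> R, (forall i, y0 i <= y i <= 0) ->
      P [set w | forall i, Y i w <= y i] = (1 - N y)%E.

Definition process (R : realType) (dT : measure_display)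
    (T : measurableType dT) (X : R -> T -> R) : Prop :=
  forall t, unitI R t -> measurable_fun [set: T] (X t).

Definition gen_process (R : realType) (dT : measure_display)
    (T : measurableType dT) (Q : probability T R) (Z : R -> T -> R) : Prop :=
  [/\ process Z,
      {ae Q, forall w, Cplus (Z ^~ w)},
      exists2 c : R, 1 <= c &
        forall t, unitI R t -> {ae Q, forall w, Z t w <= c}
    & forall t, unitI R t -> ('E_Q[Z t] = 1)%E].

Definition Dnorm_fun (R : realType) (dT : measure_display)
    (T : measurableType dT) (Q : probability T R) (Z : R -> T -> R)
    (f : R -> R) : \bar R :=
  ('E_Q[(fun w => sup [set `|f t| * Z t w | t in unitI R])%R])%E.

Definition generates (R : realType) (dT : measure_display)
    (T : measurableType dT) (Q : probability T R) (Z : R -> T -> R)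
    (N : (R -> R) -> \bar R) : Prop :=
  gen_process Q Z /\ forall f, Efun f -> N f = Dnorm_fun Q Z f.

(* The generator may live on any probability space. *)
Definition is_Dnorm (R : realType) (N : (R -> R) -> \bar R) : Prop :=
  exists (dT : measure_display) (T : measurableType dT)
         (Q : probability T R) (Z : R -> T -> R), generates Q Z N.

Definition SGPP_Dnorm (R : realType) (dT : measure_display)
    (T : measurableType dT) (P : probability T R) (V : R -> T -> R)
    (N : (R -> R) -> \bar R) : Prop :=
  [/\ process V,
      {ae P, forall w, Cminus (V ^~ w)},
      is_Dnorm N
    & exists2 c0 : R, 0 < c0 & forall f, Eminus f -> supnorm f <= c0 ->
        prob_eq P [set w | forall t, unitI R t -> V t w <= f t] (1 - N f)%E].

Definition SGPP (R : realType) (dT : measure_display)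
    (T : measurableType dT) (P : probability T R) (V : R -> T -> R) : Prop :=
  exists N : (R -> R) -> \bar R, SGPP_Dnorm P V N.

Definition SGPP_generator (R : realType) (dT dS : measure_display)
    (T : measurableType dT) (P : probability T R) (V : R -> T -> R)
    (S : measurableType dS) (Q : probability S R) (Z : R -> S -> R) : Prop :=
  exists2 N : (R -> R) -> \bar R, SGPP_Dnorm P V N & generates Q Z N.

(* The quotient is that of \bar R, where 0^-1 = +oo, so that x / 0 = -oo for
   x < 0. *)
Definition Vext (R : realType) (T : Type) (d : nat)
    (Y : 'I_d.+1 -> T -> R) (g : 'I_d.+1 -> R -> R) (t : R) (w : T) : \bar R :=
  (\big[maxe/-oo]_(i < d.+1) ((Y i w)%:E / (g i t)%:E))%E.

Definition Vproc (R : realType) (T : Type) (d : nat)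
    (Y : 'I_d.+1 -> T -> R) (g : 'I_d.+1 -> R -> R) (t : R) (w : T) : R :=
  fine (Vext Y g t w).

Definition Zhat (R : realType) (T : Type) (d : nat)
    (Z : 'I_d.+1 -> T -> R) (g : 'I_d.+1 -> R -> R) (t : R) (w : T) : R :=
  omax (fun i => g i t * Z i w).

(* Main.v *)
(* Almost surely all Y_i < 0, and then V_t = - 1 / max_i (g_i(t) / - Y_i), which
   is finite, continuous and nonpositive because for every t some g_i(t) > 0.
   For f <= 0, V <= f on [0,1] holds iff Y_i <= - sup_t |f(t)| g_i(t) for all i.
   Since g_i <= 1, these thresholds are small when f is, so the GPD gives the
   probability 1 - E(max_i sup_t (|f(t)| g_i(t)) Z_i); exchanging max and sup
   turns the expectation into E(sup_t |f(t)| max_i (g_i(t) Z_i)). *)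
Require Import Defs.
From HB Require Import structures.
From mathcomp Require Import all_boot all_order all_algebra.
From mathcomp Require Import all_classical all_reals all_analysis.
From mathcomp Require Import measurable_realfun.

Set Implicit Arguments.
Unset Strict Implicit.
Unset Printing Implicit Defensive.

Import Order.TTheory GRing.Theory Num.Theory.
Import numFieldNormedType.Exports.
Local Open Scope classical_set_scope.
Local Open Scope ring_scope.

(** * Integrals of almost surely equal functions *)

(* No measurability is assumed: the integral of [Dnorm_fun] involves a supremum
   over uncountably many t, controlled only almost surely. *)
Section negligible_integral.
Import HBNNSimple.

(** The left integral is a supremum over simple functions below [f]. Setting such a function to 0 on
    the null set [N] keeps its integral and puts it below [g]. *)
Lemma ge0_negligible_le_integral (d : measure_display) (T : measurableType d)
    (R : realType) (mu : {measure set T -> \bar R}) (N : set T)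
    (f g : T -> \bar R) :
  measurable N -> mu N = 0%E -> (forall x, 0 <= f x)%E ->
  (forall x, 0 <= g x)%E -> (forall x, ~ N x -> f x = g x) ->
  (\int[mu]_x f x <= \int[mu]_x g x)%E.
Proof.
move=> mN N0 f0 g0 fg; rewrite !ge0_integralTE//.
apply: ge_ereal_sup => _ [h /= hf <-].
have mD : measurable ([set: T] `\` N) by exact: measurableD.
have -> : sintegral mu h = sintegral mu (proj_nnsfun h mD).
  rewrite -mrestrict -integral_nnsfun//.
  rewrite -(ge0_negligible_integral mN measurableT _ _ N0)//; last 2 first.
  - exact/measurable_EFinP.
  - by move=> x _; rewrite lee_fin.
  by rewrite integral_nnsfun// patch_setT.
apply: ereal_sup_ubound; exists (proj_nnsfun h mD) => // x.
rewrite -mrestrict /patch; case: ifPn => [|_]; last exact: g0.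
by rewrite inE => -[_ /fg <-].
Qed.

End negligible_integral.

Lemma ae_eq_integral_nonmeasurable (d : measure_display)
    (T : measurableType d) (R : realType) (mu : {measure set T -> \bar R})
    (f g : T -> \bar R) :
  {ae mu, forall x, f x = g x} -> (\int[mu]_x f x = \int[mu]_x g x)%E.
Proof.
case=> N [mN N0 fgN].
have fg x : ~ N x -> f x = g x by move=> Nx; apply: contrapT => /fgN.
rewrite integralE [RHS]integralE; congr (_ - _)%E; apply/eqP;
  rewrite eq_le; apply/andP; split;
  by apply: (@ge0_negligible_le_integral _ _ _ _ N) => // x /fg;
     rewrite ?(funeposE, funenegE) => ->.
Qed.

Lemma ae_eq_expectation (d : measure_display) (T : measurableType d)
    (R : realType) (P : probability T R) (X Y : T -> R) :
  {ae P, forall w, X w = Y w} -> ('E_P[X] = 'E_P[Y])%E.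
Proof.
move=> XY; rewrite unlock; apply: ae_eq_integral_nonmeasurable.
by apply: filterS XY => w ->.
Qed.

(** * Finite maxima: limits, attainment, measurability *)

Lemma cvg_maxr (R : realType) (T : Type) (G : set_system T) (FG : Filter G)
    (f g : T -> R) (a b : R) :
  f x @[x --> G] --> a -> g x @[x --> G] --> b ->
  Num.max (f x) (g x) @[x --> G] --> Num.max a b.
Proof.
move=> fa gb; rewrite maxr_absE.
rewrite (_ : (fun x => _) = (fun x => (f x + g x + `|f x - g x|) / 2)).
  apply: cvgM; last exact: cvg_cst.
  by apply: cvgD; [exact: cvgD|apply: cvg_norm; exact: cvgB].
by apply/funext => x; rewrite maxr_absE.
Qed.

Section omax.
Context {R : realType} {d : nat}.
Implicit Types F : 'I_d.+1 -> R.

Lemma le_omax F i : F i <= omax F.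
Proof. exact: le_bigmax. Qed.

Lemma omax_le F m : (forall i, F i <= m) -> omax F <= m.
Proof. by move=> Fm; apply: bigmax_le. Qed.

Lemma omax_attained F : exists i, omax F = F i.
Proof.
apply: (big_ind (fun m => exists i, m = F i)).
- by exists ord0.
- move=> _ _ [i ->] [j ->].
  by rewrite maxEle; case: ifP; [exists j|exists i].
- by move=> i _; exists i.
Qed.

Lemma measurable_omax (dT : measure_display) (T : measurableType dT)
    (F : 'I_d.+1 -> T -> R) : (forall i, measurable_fun [set: T] (F i)) ->
  measurable_fun [set: T] (fun w => omax (fun i => F i w)).
Proof.
move=> mF; rewrite /omax; elim: (index_enum _) => [|i s IHs].
  under eq_fun do rewrite big_nil.
  exact: mF.
under eq_fun do rewrite big_cons.
exact: measurable_maxr.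
Qed.

Lemma cvg_omax (T : Type) (G : set_system T) (FG : Filter G)
    (F : 'I_d.+1 -> T -> R) (l : 'I_d.+1 -> R) :
  (forall i, F i x @[x --> G] --> l i) ->
  omax (fun i => F i x) @[x --> G] --> omax l.
Proof.
move=> Fl; rewrite /omax; elim: (index_enum _) => [|i s IHs].
  rewrite big_nil; under eq_fun do rewrite big_nil.
  exact: Fl.
rewrite big_cons; under eq_fun do rewrite big_cons.
exact: cvg_maxr.
Qed.

End omax.

(** * Weighted suprema over [0,1] *)

Section weighted_sup.
Context {R : realType}.
Implicit Types (f h : R -> R) (C : R).

(** For [h] one of the [g i], its negative is the threshold for [Y i]; for [h] a path of [Zhat], it
    is the integrand of [Dnorm_fun]. *)
Definition weighted_sup f h : R := sup [set `|f t| * h t | t in unitI R].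

Lemma unitI0 : unitI R 0.
Proof. by rewrite /unitI /= in_itv /= lexx ler01. Qed.

Lemma weighted_sup_le f h C :
  (forall t, unitI R t -> `|f t| * h t <= C) -> weighted_sup f h <= C.
Proof.
move=> fhC; apply: ge_sup => [|_ [t It <-]]; last exact: fhC.
by exists (`|f 0| * h 0); exists 0 => //; exact: unitI0.
Qed.

Lemma le_weighted_sup f h C t :
  (forall u, unitI R u -> `|f u| * h u <= C) -> unitI R t ->
  `|f t| * h t <= weighted_sup f h.
Proof.
move=> fhC It; apply: ub_le_sup; last by exists t.
by exists C => _ [u Iu <-]; exact: fhC.
Qed.

End weighted_sup.

(** * Both processes along a single path *)

Section finite_maximum.
Context {R : realType} {d : nat} {T : Type}.
Variables (X : 'I_d.+1 -> T -> R) (g : 'I_d.+1 -> R -> R).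
Hypothesis g_ge0 : forall i t, unitI R t -> 0 <= g i t.

(** The map x -> -1/x increases on positive reals, so it commutes with the maximum. An index with
    [g i t = 0] contributes -oo on the left and 0 on the right, and is maximal on neither side
    because some [g i t] is positive. *)
Lemma Vext_omax t w : unitI R t -> (exists i, 0 < g i t) ->
  (forall i, X i w < 0) ->
  Vext X g t w = (- (omax (fun i => g i t / - X i w))^-1)%:E.
Proof.
move=> It [j gj] X0; set F := fun i => _.
have M0 : 0 < omax F.
  by rewrite (lt_le_trans _ (le_omax F j))// divr_gt0// oppr_gt0.
apply/eqP; rewrite eq_le; apply/andP; split.
  apply: bigmax_le => [|i _]; first exact: leNye.
  have := g_ge0 i It; rewrite (le_eqVlt 0) => /predU1P[<-|gi].
    by rewrite inve0 lt0_muley ?lte_fin// leNye.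
  rewrite inver gt_eqF// -EFinM lee_fin lerNr -mulNr -invf_div.
  by rewrite lef_pV2 ?posrE ?divr_gt0 ?oppr_gt0//; exact: le_omax.
have [i Mi] := omax_attained F.
have gi : 0 < g i t.
  have := g_ge0 i It; rewrite (le_eqVlt 0) => /predU1P[gi|//].
  by move: M0; rewrite Mi /F -gi mul0r ltxx.
apply: le_trans (le_bigmax _ _ i).
by rewrite inver gt_eqF// -EFinM lee_fin Mi invf_div mulNr opprK.
Qed.

Hypothesis g_gt0 : forall t, unitI R t -> exists i, 0 < g i t.

Lemma Vproc_omax t w : unitI R t -> (forall i, X i w < 0) ->
  Vproc X g t w = - (omax (fun i => g i t / - X i w))^-1.
Proof. by move=> It X0; rewrite /Vproc Vext_omax//; exact: g_gt0. Qed.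

Lemma omax_div_gt0 t w : unitI R t -> (forall i, X i w < 0) ->
  0 < omax (fun i => g i t / - X i w).
Proof.
move=> It X0; have [i gi] := g_gt0 It.
apply: lt_le_trans (le_omax _ i).
by rewrite divr_gt0// oppr_gt0.
Qed.

(** The quotients g_i / (-X_i) stay continuous where g_i vanishes, and their maximum is positive, so
    it can be inverted. *)
Lemma Cminus_Vproc w : (forall i, {within unitI R, continuous (g i)}) ->
  (forall i, X i w < 0) -> Cminus (Vproc X g ^~ w).
Proof.
move=> cg X0; split; last first.
  by move=> t It; rewrite Vproc_omax// oppr_le0 invr_ge0 ltW// omax_div_gt0.
have cM t : unitI R t ->
    - (omax (fun i => g i x / - X i w))^-1 @[x --> within (unitI R) (nbhs t)]
    --> - (omax (fun i => g i t / - X i w))^-1.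
  move=> It; apply: cvgN; apply: cvgV; first by rewrite gt_eqF// omax_div_gt0.
  apply: cvg_omax => i; apply: cvgM; last exact: cvg_cst.
  by have /subspace_continuousP := cg i; exact.
apply/subspace_continuousP => t It.
change (Vproc X g x w @[x --> within (unitI R) (nbhs t)] --> Vproc X g t w).
rewrite Vproc_omax//; apply: cvg_trans (cM t It); apply: near_eq_cvg.
by rewrite near_withinE; apply: nearW => x Ix /=; rewrite Vproc_omax.
Qed.

Variables (f : R -> R) (C : R).
Hypothesis g_le1 : forall i t, unitI R t -> g i t <= 1.
Hypothesis fC : forall t, unitI R t -> `|f t| <= C.

Lemma normM_le i t : unitI R t -> `|f t| * g i t <= C.
Proof.
move=> It; apply: le_trans (fC It).
by rewrite ler_piMr// g_le1.
Qed.

Lemma weighted_sup_ge0 i : 0 <= weighted_sup f (g i).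
Proof.
apply: le_trans (le_weighted_sup (@normM_le i) unitI0).
by rewrite mulr_ge0// g_ge0//; exact: unitI0.
Qed.

(** Pointwise in t, both sides say |f(t)| g_i(t) <= -X_i for all i; in this product form f(t) = 0 is
    no special case. *)
Lemma Vproc_leP w : (forall t, unitI R t -> f t <= 0) ->
  (forall i, X i w < 0) ->
  (forall t, unitI R t -> Vproc X g t w <= f t) <->
  (forall i, X i w <= - weighted_sup f (g i)).
Proof.
move=> f0 X0; split=> [Vf i|Xf t It].
  rewrite lerNr; apply: weighted_sup_le => t It.
  have := Vf t It; rewrite Vproc_omax// lerNl -(ler0_norm (f0 t It)).
  have M0 := omax_div_gt0 It X0.
  rewrite -[leRHS]mul1r ler_pdivlMr// => fM.
  rewrite -[leRHS]mul1r -ler_pdivrMr ?oppr_gt0// -mulrA.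
  by apply: le_trans fM; rewrite ler_wpM2l// (le_omax (fun i => _ / - X i w)).
have M0 := omax_div_gt0 It X0.
rewrite Vproc_omax// lerNl -(ler0_norm (f0 t It)) -[leRHS]mul1r ler_pdivlMr//.
have [i ->] := omax_attained (fun i => g i t / - X i w).
rewrite mulrA ler_pdivrMr ?oppr_gt0// mul1r lerNr.
apply: le_trans (Xf i) _; rewrite lerN2.
exact: le_weighted_sup (@normM_le i) It.
Qed.

Lemma weighted_sup_Zhat w : (forall i, 0 <= X i w) ->
  weighted_sup f (Zhat X g ^~ w) =
  omax (fun i => weighted_sup f (g i) * X i w).
Proof.
move=> X0.
have ub t : unitI R t -> `|f t| * Zhat X g t w <=
    omax (fun i => weighted_sup f (g i) * X i w).
  move=> It; rewrite /Zhat.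
  have [i ->] := omax_attained (fun i => g i t * X i w).
  apply: le_trans (le_omax _ i); rewrite mulrA ler_wpM2r//.
  exact: le_weighted_sup (@normM_le i) It.
apply/eqP; rewrite eq_le weighted_sup_le//=; apply: omax_le => i.
(* The factor [X i w] leaves the supremum by division, so the value 0 is treated apart; there
   nonnegativity of the other side, seen at t = 0, suffices. *)
have := X0 i; rewrite (le_eqVlt 0) => /predU1P[<-|Xi].
  rewrite mulr0; apply: le_trans (le_weighted_sup ub unitI0).
  rewrite mulr_ge0//; apply: le_trans (le_omax _ i).
  by rewrite mulr_ge0// g_ge0//; exact: unitI0.
rewrite -ler_pdivlMr//; apply: weighted_sup_le => t It.
rewrite ler_pdivlMr//; apply: le_trans (le_weighted_sup ub It).
by rewrite -mulrA ler_wpM2l// (le_omax (fun i => g i t * X i w)).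
Qed.

End finite_maximum.

(** * The generator process and its D-norm *)

Section generator.
Context {R : realType} {d : nat} {dS : measure_display} {S : measurableType dS}.
Variables (Q : probability S R) (Z : 'I_d.+1 -> {RV Q >-> R}).
Variable g : 'I_d.+1 -> R -> R.
Hypothesis hZ : gen_vector Z.
Hypothesis hg : forall i, Cplus (g i).
Hypothesis hg1 : forall t, unitI R t -> Dnorm_vec Z (fun i => g i t) = 1%E.

Lemma ae_ge0_Z : {ae Q, forall w, forall i, 0 <= Z i w}.
Proof. by case: hZ => Z0 _ _; exact: filter_forall. Qed.

Lemma expectation_Zhat t : unitI R t -> ('E_Q[Zhat Z g t] = 1)%E.
Proof.
move=> It; rewrite -(hg1 It); congr expectation; apply/funext => w.
rewrite /Zhat; congr omax; apply/funext => i.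
by rewrite ger0_norm// (hg i).2.
Qed.

Lemma measurable_Zhat t : measurable_fun [set: S] (Zhat Z g t).
Proof.
by apply: measurable_omax => i; exact: measurable_funM.
Qed.

(** If all g_i(t) vanished, [Zhat] would be 0 at time t, with expectation 0 instead of 1. *)
Lemma generator_coeff_gt0 t : unitI R t -> exists i, 0 < g i t.
Proof.
move=> It; apply: contrapT => /forallNP g0.
have := expectation_Zhat It; rewrite (_ : Zhat Z g t = cst 0).
  by rewrite expectation_cst => -[] /esym/eqP; rewrite oner_eq0.
apply/funext => w; rewrite /Zhat /=.
have [i ->] := omax_attained (fun i => g i t * Z i w).
have -> : g i t = 0; last by rewrite mul0r.
by apply/eqP; rewrite eq_le (hg i).2// andbT leNgt; apply/negP/g0.
Qed.

(* g_i(t) = E(g_i(t) Z_i) <= E(max_j g_j(t) Z_j) = 1. *)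
Lemma generator_coeff_le1 i t : unitI R t -> g i t <= 1.
Proof.
move=> It; have [_ _ EZ] := hZ; have g0 := (hg i).2 t It.
(* [Z i] is nonnegative only almost surely; positive parts, here and for [Zhat], give the
   nonnegativity everywhere that [expectation_le] is given below. *)
pose Zp w := Num.max (Z i w) 0.
have mZp : measurable_fun [set: S] Zp.
  exact: measurable_maxr.
have Zp0 w : 0 <= Zp w by rewrite le_max lexx orbT.
have EZp : ('E_Q[Zp] = 1)%E.
  rewrite -(EZ i); apply: ae_eq_expectation.
  by apply: filterS ae_ge0_Z => w Z0; rewrite /Zp max_l.
have : ('E_Q[(fun w => g i t * Zp w)%R] <=
        'E_Q[(fun w => Num.max (Zhat Z g t w) 0)%R])%E.
  apply: expectation_le.
  - exact: measurable_funM.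
  - by apply: measurable_maxr => //; exact: measurable_Zhat.
  - by move=> w; rewrite mulr_ge0.
  - by move=> w; rewrite le_max lexx orbT.
  apply: filterS ae_ge0_Z => w Z0; rewrite /Zp max_l//.
  by rewrite le_max (le_omax (fun i => g i t * Z i w)).
have -> : ('E_Q[(fun w => Num.max (Zhat Z g t w) 0)%R] = 1)%E.
  rewrite -(expectation_Zhat It); apply: ae_eq_expectation.
  apply: filterS ae_ge0_Z => w Z0; rewrite max_l//.
  apply: le_trans (le_omax _ i).
  by rewrite mulr_ge0.
have -> : ('E_Q[(fun w => g i t * Zp w)%R] = (g i t)%:E * 'E_Q[Zp])%E.
  rewrite unlock -ge0_integralZl_EFin//.
    by move=> w _; rewrite lee_fin.
  exact/measurable_EFinP.
by rewrite EZp mule1 lee_fin.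
Qed.

Lemma gen_process_Zhat : gen_process Q (Zhat Z g).
Proof.
split.
- by move=> t _; exact: measurable_Zhat.
- apply: filterS ae_ge0_Z => w Z0; split.
    apply/subspace_continuousP => t It; apply: cvg_omax => i.
    apply: cvgM; last exact: cvg_cst.
    by have /subspace_continuousP := (hg i).1; exact.
  move=> t It; apply: le_trans (le_omax _ ord0).
  by rewrite mulr_ge0// (hg ord0).2.
(* As g_i <= 1, the bound [c] of the [Z i] also bounds [Zhat]. *)
- have [_ [c c1 Zc] _] := hZ; exists c => // t It.
  have := @filter_forall _ _ _ _ _ Zc => /(_ _).
  apply: filterS2 ae_ge0_Z => w Z0 {}Zc; apply: omax_le => i.
  by apply: le_trans (Zc i); rewrite ler_piMl// generator_coeff_le1.
- by move=> t It; exact: expectation_Zhat.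
Qed.

(** The minus sign makes the argument the point where the GPD is evaluated; the norm sees only
    absolute values. *)
Lemma Dnorm_fun_Zhat (f : R -> R) (C : R) :
  (forall t, unitI R t -> `|f t| <= C) ->
  Dnorm_fun Q (Zhat Z g) f = Dnorm_vec Z (fun i => - weighted_sup f (g i)).
Proof.
move=> fC; apply: ae_eq_expectation; apply: filterS ae_ge0_Z => w Z0.
have g_ge0 i t (It : unitI R t) := (hg i).2 t It.
rewrite -/(weighted_sup f (Zhat Z g ^~ w)).
rewrite (weighted_sup_Zhat g_ge0 generator_coeff_le1 fC Z0).
congr omax; apply/funext => i; congr (_ * _).
by rewrite normrN ger0_norm// (weighted_sup_ge0 g_ge0 generator_coeff_le1 fC).
Qed.

End generator.

(** * Measurability, and passage from the GPD to the process *)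

Lemma measurable_Vproc (R : realType) (d : nat) (dT : measure_display)
    (T : measurableType dT) (Y : 'I_d.+1 -> T -> R) (g : 'I_d.+1 -> R -> R)
    (t : R) : (forall i, measurable_fun [set: T] (Y i)) ->
  measurable_fun [set: T] (Vproc Y g t).
Proof.
move=> mY; apply: (measurableT_comp (@fine_measurable R setT measurableT)).
rewrite /Vext; elim: (index_enum _) => [|i s IHs].
  under eq_fun do rewrite big_nil.
  exact: measurable_cst.
under eq_fun do rewrite big_cons.
apply: measurable_maxe => //; apply: emeasurable_funM => //.
exact/measurable_EFinP.
Qed.

Lemma measurable_forall_le (R : realType) (d : nat) (dT : measure_display)
    (T : measurableType dT) (Y : 'I_d.+1 -> T -> R) (y : 'I_d.+1 -> R) :
  (forall i, measurable_fun [set: T] (Y i)) ->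
  measurable [set w | forall i, Y i w <= y i].
Proof.
move=> mY; rewrite (_ : mkset _ = \bigcap_(i in setT) [set w | Y i w <= y i]).
  apply: fin_bigcap_measurable => // i _.
  by rewrite -[mkset _]setTI; exact: measurable_fun_le.
by apply/seteqP; split=> w /= H i; [move=> _|]; exact: H.
Qed.

Lemma le_supnorm (R : realType) (f : R -> R) (C : R) (t : R) :
  (forall u, unitI R u -> `|f u| <= C) -> unitI R t -> `|f t| <= supnorm f.
Proof.
move=> fC It; apply: ub_le_sup; last by exists t.
by exists C => _ [u Iu <-]; exact: fC.
Qed.

(** The first conjunct ensures that, almost surely, [fine] in [Vproc] discards no infinite value. *)
Theorem lemma4p1 (R : realType) (d : nat)
    (dT : measure_display) (T : measurableType dT) (P : probability T R)
    (dS : measure_display) (S : measurableType dS) (Q : probability S R)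
    (Y : 'I_d.+1 -> {RV P >-> R}) (Z : 'I_d.+1 -> {RV Q >-> R})
    (g : 'I_d.+1 -> R -> R)
    (hZ : gen_vector Z)
    (hY : standard_GPD Y (Dnorm_vec Z))
    (hYneg : forall i, {ae P, forall w, Y i w < 0})
    (hg : forall i, Cplus (g i))
    (hg1 : forall t, unitI R t -> Dnorm_vec Z (fun i => g i t) = 1%E) :
  [/\ {ae P, forall w, forall t, unitI R t -> Vext Y g t w \is a fin_num},
      SGPP P (Vproc Y g)
    & SGPP_generator P (Vproc Y g) Q (Zhat Z g)].
Proof.
have aeY : {ae P, forall w, forall i, Y i w < 0} by exact: filter_forall.
have g_ge0 i t (It : unitI R t) := (hg i).2 t It.
have g_gt0 := generator_coeff_gt0 hg hg1.
have g_le1 := generator_coeff_le1 hZ hg hg1.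
have genZ : generates Q (Zhat Z g) (Dnorm_fun Q (Zhat Z g)).
  by split => //; exact: gen_process_Zhat.
have VN : SGPP_Dnorm P (Vproc Y g) (Dnorm_fun Q (Zhat Z g)).
  split.
  - by move=> t _; exact: measurable_Vproc.
  - apply: filterS aeY => w Y0.
    by apply: Cminus_Vproc => // i; exact: (hg i).1.
  - by exists dS, S, Q, (Zhat Z g).
  (* The radius c0 is the least distance of an entry of [y0] from 0. *)
  have [y0 y00 PY] := hY; exists (- omax y0).
    by have [i ->] := omax_attained y0; rewrite oppr_gt0.
  move=> f [[[C fC] _] f0] fc0; pose s i := weighted_sup f (g i).
  (* This event has finitely many conditions and differs from the one over all t only where some
     [Y i] is not negative. *)
  exists [set w | forall i, Y i w <= - s i]; split.
  - exact: measurable_forall_le.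
  - apply: negligibleS aeY => w AB Y0; move: AB.
    have [AB BA] :=
      Vproc_leP (X := fun i => Y i) g_ge0 g_gt0 g_le1 fC f0 Y0.
    by move=> [[/AB]|[/BA]].
  - rewrite (Dnorm_fun_Zhat hZ hg hg1 fC); apply: PY => i.
    rewrite oppr_le0 (weighted_sup_ge0 g_ge0 g_le1 fC) andbT.
    rewrite lerNr; apply: weighted_sup_le => t It.
    (* The chain is |f(t)| g_i(t) <= [supnorm f] <= c0 <= [- y0 i], which places the thresholds in
       the range of the GPD formula. *)
    apply: le_trans (normM_le g_le1 (fun u => le_supnorm fC) i It) _.
    by apply: le_trans fc0 _; rewrite lerN2 le_omax.
split.
- apply: filterS aeY => w Y0 t It.
  by rewrite (Vext_omax g_ge0 It (g_gt0 t It) Y0).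
- by exists (Dnorm_fun Q (Zhat Z g)).
- by exists (Dnorm_fun Q (Zhat Z g)).
Qed.
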